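(* Let $1\le k<n$. The set of $k\times(n-k)$ Cauchon diagrams is in bijective correspondence with the set of affine bottom pipe dreams in the ground state case $\lambda=(1,\dots,k)$, i.e. on the $k\times(n-k)$ rectangle.
   Context: A **Cauchon diagram** of size $m\times p$ is an $m\times p$ grid of squares, some of which are coloured black and the rest white, such that if a square is black, then either every square strictly to its left (in its row) is black, or every square strictly above it (in its column) is black. **Affine pipe dreams in the ground state case** $\lambda=(1,\dots,k)$. The affine strip consists of copies of a $k\times(n-k)$ rectangle repeated periodically along a northwest–southeast diagonal, meeting only at corners, so a periodic filling is determined by a filling of one rectangle. An affine pipe dream fills each box of the rectangle with either a cross tile (west side joined to east side, south side joined to north side) or an elbow tile (west side joined to north side, south side joined to east side). Pipes enter through the west and south edges of the rectangle and leave through the north and east edges. The filling is required to be reduced: no two pipes cross more than once. Number the entering edges $1,\dots,n$: first the west edges from north to south, then the south edges from west to east. Number the exiting edges $k+1,\dots,k+n$: first the north edges from west to east, then the east edges from north to south. The associated affine permutation $\pi$ sends $i\in[n]$ to the label of the exit of the pipe entering at $i$, extended by $\pi(i+n)=\pi(i)+n$. **Bottom pipe dreams.** Order the boxes of the rectangle by reading rows from south to north and each row from west to east. Then a pipe dream is determined by the increasing sequence of positions of its cross tiles. All reduced affine pipe dreams with the same $\pi$ have the same number of crosses. The affine bottom pipe dream of $\pi$ is the one whose position sequence is lexicographically last among all reduced affine pipe dreams with affine permutation $\pi$. A pipe dream is an affine bottom pipe dream if it is the affine bottom pipe dream of its own affine permutation. *)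

(* Defs.v *)
From mathcomp Require Import all_boot all_order all_algebra.
From mathcomp Require Import classical_sets functions.

Set Implicit Arguments.
Unset Strict Implicit.
Unset Printing Implicit Defensive.

Import Order.TTheory GRing.Theory Num.Theory.

(* In all the grids 'M[bool]_(k, m), row 0 is the northernmost row and column 0
   is the westernmost column. *)

(* [true] is a black square. *)
Definition cauchon (m p : nat) (C : 'M[bool]_(m, p)) : bool :=
  [forall i : 'I_m, forall j : 'I_p, C i j ==>
     ([forall j' : 'I_p, (j' < j) ==> C i j']
      || [forall i' : 'I_m, (i' < i) ==> C i' j])].

(* A filling of the k x m rectangle, n = k + m; [true] is a cross tile and
   [false] an elbow tile.  The copies of the rectangle in the affine strip meet
   only at corners, so a pipe never leaves its rectangle and two pipes can only
   cross inside one rectangle. *)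
Definition filling (k m : nat) : predArgType := 'M[bool]_(k, m).

(* Unit edges of the rectangle: [inl (i, c)] is the vertical edge in row i on
   the c-th vertical grid line, [inr (r, j)] is the horizontal edge in column j
   on the r-th horizontal grid line, lines being counted from the west and from
   the north respectively. *)
Definition edge (k m : nat) : predArgType :=
  ('I_k * 'I_m.+1 + 'I_k.+1 * 'I_m)%type.

Definition west (k m : nat) (i : 'I_k) (j : 'I_m) : edge k m :=
  inl (i, lift ord_max j).
Definition east (k m : nat) (i : 'I_k) (j : 'I_m) : edge k m :=
  inl (i, lift ord0 j).
Definition north (k m : nat) (i : 'I_k) (j : 'I_m) : edge k m :=
  inr (lift ord_max i, j).
Definition south (k m : nat) (i : 'I_k) (j : 'I_m) : edge k m :=
  inr (lift ord0 i, j).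

(* The edge by which a pipe leaves the box that it enters through e, i.e. the
   box (i, j) with e = west i j or e = south i j; edges on the north and east
   boundary of the rectangle are fixed. *)
Definition next_edge (k m : nat) (D : filling k m) (e : edge k m) : edge k m :=
  match e with
  | inl (i, c) =>
      if unlift ord_max c is Some j
      then if D i j then east i j else north i j else e
  | inr (r, j) =>
      if unlift ord0 r is Some i
      then if D i j then north i j else east i j else e
  end.

(* The entering edge with label i + 1. *)
Definition entry (k m : nat) (i : 'I_(k + m)) : edge k m :=
  match fintype.split i with
  | inl a => inl (a, ord0)
  | inr j => inr (ord_max, j)
  end.

(* Only meaningful on the north and east boundary. *)
Definition exit_label (k m : nat) (e : edge k m) : nat :=
  match e with
  | inl (a, _) => k + m + a.+1
  | inr (_, j) => k + j.+1
  end.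

(* A pipe goes through fewer than k + m boxes, so k + m steps reach its exit. *)
Definition pipe_exit (k m : nat) (D : filling k m) (i : 'I_(k + m)) : nat :=
  exit_label (iter (k + m) (next_edge D) (entry i)).

(* Pipes are numbered by their entering edges. *)
Definition on_pipe (k m : nat) (D : filling k m) (i : 'I_(k + m)) :
    pred (edge k m) :=
  fun e => fconnect (next_edge D) (entry i) e.

Definition crossings (k m : nat) (D : filling k m) (a b : 'I_(k + m)) :
    {set 'I_k * 'I_m} :=
  [set x : 'I_k * 'I_m | D x.1 x.2 &&
     (on_pipe D a (west x.1 x.2) && on_pipe D b (south x.1 x.2)
      || on_pipe D b (west x.1 x.2) && on_pipe D a (south x.1 x.2))].

Definition reduced (k m : nat) (D : filling k m) : bool :=
  [forall a : 'I_(k + m), forall b : 'I_(k + m),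
     (a != b) ==> (#|crossings D a b| <= 1)].

(* Writing x = (i + 1) + q * n with 0 <= i < n, the value at x is
   pi (i + 1) + q * n.  The last branch only occurs when n = 0. *)
Definition affine_perm (k m : nat) (D : filling k m) (x : int) : int :=
  let n : int := (k + m)%N in
  if insub `|((x - 1)%R %% n)%Z|%N is Some i
  then ((pipe_exit D i)%:Z + ((x - 1)%R %/ n)%Z * n)%R
  else x.

(* Rows from south to north, each row from west to east. *)
Definition position (k m : nat) (x : 'I_k * 'I_m) : nat :=
  (k - x.1.+1) * m + x.2.

Definition cross_positions (k m : nat) (D : filling k m) : seqlexi nat :=
  sort leq [seq position x | x <- enum [set x : 'I_k * 'I_m | D x.1 x.2]].

Definition bottom_of (k m : nat) (f : int -> int) (D : filling k m) : Prop :=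
  [/\ reduced D, affine_perm D =1 f &
      forall D' : filling k m, reduced D' -> affine_perm D' =1 f ->
        (cross_positions D' <= cross_positions D)%O].

Definition affine_bottom (k m : nat) (D : filling k m) : Prop :=
  bottom_of (affine_perm D) D.

(* Main.v *)
Require Import Defs.
From mathcomp Require Import all_boot all_order all_algebra.
From mathcomp Require Import classical_sets functions.
From mathcomp Require Import zify.
Import Order.TTheory.

Set Implicit Arguments.
Unset Strict Implicit.
Unset Printing Implicit Defensive.

(** Read along antidiagonals, the rectangle is a wiring diagram on the strands
0, ..., k + m - 1: an elbow keeps both of its pipes on their strands, and a
cross in row i and column j exchanges the strands i + j and i + j + 1.  The
pipe entering at a strand starts there, and its exit label is k + 1 plus the
strand on which it ends.  So a filling is a subword of a fixed word of adjacent
transpositions, its affine permutation is the product of that subword, and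
crossings can be located by processing the boxes in the order of their
positions.

The bijection reflects a Cauchon diagram left to right and turns black squares
into crosses.  Its image consists of the fillings called [straight_out] below:
from each cross there are only crosses to the east, or only crosses to the
north.  These are exactly the affine bottom pipe dreams, for three reasons.

In a straight-out filling, one of the two pipes leaving a cross runs straight
to the boundary and confines the other to one side of it, so the two never meet
again and the filling is reduced ([straight_out_crosses_once]).

If a filling has the same permutation as a straight-out one and agrees with it
before a box where the latter has a cross, it has a cross there as well: otherwise the straight pipe is
replaced by one that turns off and cannot come back to the same exit
([straight_out_cross_forced]).  Hence at the first difference with a reduced
filling with the same permutation, the straight-out filling has the elbow.  It
must also have a later cross, because otherwise the pair of pipes crossed
there would end up in different orders in the two fillings
([lost_crossing_visible]).  So the straight-out filling is
lexicographically last ([straight_out_max]).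

If a filling is not straight-out, it contains a cross whose two pipes meet
again at a later box ([kiss_rectangle], [pipes_kiss]).  Changing the tiles of
both boxes preserves the permutation ([flip_same_perm]) and moves the crosses
later or removes them.  Iterating this yields a straight-out filling with the
same permutation ([straight_out_exists]); by antisymmetry of the lexicographic
order, an affine bottom pipe dream is equal to it. *)

(** * Words of adjacent transpositions *)

Definition swap (t s : nat) : nat :=
  if s == t then t.+1 else if s == t.+1 then t else s.

Lemma swap_cases t s :
  [\/ s = t /\ swap t s = t.+1, s = t.+1 /\ swap t s = t
    | [/\ s <> t, s <> t.+1 & swap t s = s]].
Proof.
rewrite /swap; case: eqP => [?|?]; first by constructor 1.
by case: eqP => [?|?]; [constructor 2 | constructor 3].
Qed.

Ltac swap_lia :=
  repeat match goal with |- context [swap ?t ?s] =>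
    let x := fresh in
    have := swap_cases t s; move: (swap t s) => x [[]|[]|[]] end; lia.

Lemma swapK t : involutive (swap t).
Proof. by move=> s; swap_lia. Qed.

Section Words.

Variable t : nat -> nat.
Implicit Types (d : nat -> bool) (p q r a b : nat).

(** The strand carrying the pipe that entered on strand a, after the first p
letters of the word; letter r is the transposition of the strands t r and
(t r).+1, and is applied only if d r. *)
Fixpoint wire d p a : nat :=
  if p is r.+1 then (if d r then swap (t r) (wire d r a) else wire d r a)
  else a.

Definition crossing d r a b : bool :=
  d r && ((wire d r a == t r) && (wire d r b == (t r).+1)
          || (wire d r b == t r) && (wire d r a == (t r).+1)).

Lemma eq_wire d d' p : (forall r, r < p -> d r = d' r) ->
  wire d p =1 wire d' p.
Proof.
elim: p => [|p IH] h a //=.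
by rewrite h // IH // => r hr; apply: h; lia.
Qed.

Lemma wire_inj d p : injective (wire d p).
Proof.
elim: p => [|p IH] a b //=; case: (d p) => [/(inv_inj (@swapK _))|]; exact: IH.
Qed.

Lemma wire_surj d p s : exists a, wire d p a = s.
Proof.
elim: p s => [|p IH] s; first by exists s.
rewrite /=; case: (d p); last exact: IH.
by have [a ha] := IH (swap (t p) s); exists a; rewrite ha swapK.
Qed.

Lemma wire_stay d p q a : p <= q ->
  (forall r, p <= r < q -> t r != wire d p a /\ (t r).+1 != wire d p a) ->
  wire d q a = wire d p a.
Proof.
elim: q => [|q IH] hpq h; first by have ->: p = 0 by lia.
have [->//|hne] := eqVneq p q.+1.
have e: wire d q a = wire d p a.
  by apply: IH => [|r hr]; [lia | apply: h; lia].
have [h1 h2] := h q ltac:(lia).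
by rewrite /= e; case: (d q) => //; swap_lia.
Qed.

(** A barrier may move, but a pipe can only pass above it by a transposition at
its current level; so rising barriers that avoid the letters confine pipes from
above, and falling ones from below. *)
Lemma wire_below d (th : nat -> nat) p q a :
  p <= q -> (forall r, p <= r < q -> t r != th r /\ th r <= th r.+1) ->
  wire d p a <= th p -> wire d q a <= th q.
Proof.
elim: q => [|q IH] hpq h ha; first by move: ha; have ->: p = 0 by lia.
have [<-//|hne] := eqVneq p q.+1.
have {}IH: wire d q a <= th q.
  by apply: IH => // [|r hr]; [lia | apply: h; lia].
have [h1 h2] := h q ltac:(lia).
by move: IH h1 h2; rewrite /=; case: (d q) => *; swap_lia.
Qed.

Lemma wire_above d (th : nat -> nat) p q a :
  p <= q -> (forall r, p <= r < q -> t r != th r /\ th r.+1 <= th r) ->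
  th p < wire d p a -> th q < wire d q a.
Proof.
elim: q => [|q IH] hpq h ha; first by move: ha; have ->: p = 0 by lia.
have [<-//|hne] := eqVneq p q.+1.
have {}IH: th q < wire d q a.
  by apply: IH => // [|r hr]; [lia | apply: h; lia].
have [h1 h2] := h q ltac:(lia).
by move: IH h1 h2; rewrite /=; case: (d q) => *; swap_lia.
Qed.

(** Two pipes can change their relative order only by meeting on neighbouring
strands at a cross. *)
Lemma wire_order d p q a b : p <= q ->
  (forall r, p <= r < q -> ~~ crossing d r a b) ->
  wire d p b < wire d p a -> wire d q b < wire d q a.
Proof.
elim: q => [|q IH] hpq h ha; first by move: ha; have ->: p = 0 by lia.
have [<-//|hne] := eqVneq p q.+1.
have {}IH: wire d q b < wire d q a.
  by apply: IH => // [|r hr]; [lia | apply: h; lia].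
have := h q ltac:(lia).
by move: IH; rewrite /crossing /=; case: (d q) => //= *; swap_lia.
Qed.

Lemma wire_elbows d p q a : p <= q -> (forall r, p <= r < q -> ~~ d r) ->
  wire d q a = wire d p a.
Proof.
elim: q => [|q IH] hpq h; first by have ->: p = 0 by lia.
have [->//|hne] := eqVneq p q.+1.
rewrite /= (negbTE (h q ltac:(lia))).
by apply: IH => [|r hr]; [lia | apply: h; lia].
Qed.

(** Between two meetings of a and b, changing the tiles at both amounts to
exchanging the names of a and b, and the second change restores the names. *)
Lemma wire_flip d d' p q a b :
  p < q -> d p -> d' p = false -> d' q = ~~ d q ->
  (forall r, r != p -> r != q -> d' r = d r) ->
  wire d p a = t p -> wire d p b = (t p).+1 ->
  wire d q a = (t q).+1 -> wire d q b = t q ->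
  forall r c, q < r -> wire d' r c = wire d r c.
Proof.
move=> hpq dp d'p d'q dd' pa pb qa qb.
have before c : wire d' p c = wire d p c by apply: eq_wire => r hr; apply: dd'; lia.
have inj r x y : wire d r x = wire d r y -> x = y by apply: wire_inj.
have ab: a != b by apply/eqP => e; move: pa pb; rewrite e; lia.
have between r : p < r <= q ->
    [/\ wire d' r a = wire d r b, wire d' r b = wire d r a &
        forall c, c != a -> c != b -> wire d' r c = wire d r c].
  elim: r => [|r IH] hr; first by lia.
  have [->|hne] := eqVneq r p.
    rewrite /= dp d'p !before; split; rewrite ?pa ?pb; try swap_lia.
    move=> c ca cb.
    have h1: wire d p c != t p by apply: contra_neq ca => e; apply: (inj p); lia.
    have h2: wire d p c != (t p).+1
      by apply: contra_neq cb => e; apply: (inj p); lia.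
    by rewrite /swap (negbTE h1) (negbTE h2).
  have [|h1 h2 h3] := IH; first by lia.
  rewrite /= dd'; [|lia|lia].
  by split; rewrite ?h1 ?h2 // => c ca cb; rewrite h3.
move=> r c; elim: r => [|r IH] hr //.
have [->|hne] := eqVneq r q; last by rewrite /= IH ?dd' //; lia.
have [h1 h2 h3] := between q ltac:(lia).
rewrite /= d'q.
have [->|ca] := eqVneq c a; first by rewrite h1 qa qb; case: (d q) => /=; swap_lia.
have [->|cb] := eqVneq c b; first by rewrite h2 qa qb; case: (d q) => /=; swap_lia.
have k1: wire d q c != t q by apply: contra_neq cb => e; apply: (inj q); lia.
have k2: wire d q c != (t q).+1
  by apply: contra_neq ca => e; apply: (inj q); lia.
rewrite h3 // /swap (negbTE k1) (negbTE k2).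
by case: (d q).
Qed.

(** The pipes a and b crossed by d' at p do not meet at a cross again, so d'
ends with a above b, while d leaves them on their strands, with a below b. *)
Lemma lost_crossing_visible d d' p n N :
  p < N -> (forall r, r < N -> (t r).+1 < n) ->
  (forall r, r < p -> d r = d' r) -> d' p ->
  (forall r, p <= r < N -> ~~ d r) ->
  (forall a b q, a < n -> b < n -> p < q < N ->
     crossing d' p a b -> ~~ crossing d' q a b) ->
  exists2 a, a < n & wire d N a <> wire d' N a.
Proof.
move=> hp ht dd' d'p nd red.
have [a ha] := wire_surj d p (t p).
have [b hb] := wire_surj d p (t p).+1.
have lt_n c : wire d p c < n -> c < n.
  move=> hc; case: n ht hc {red} => // n ht hc.
  rewrite ltnS leqNgt; apply/negP => h.
  have: n < wire d p c; last lia.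
  by apply: (@wire_above d (fun=> n) 0) => // r hr; have := ht r; lia.
have an: a < n by apply: lt_n; rewrite ha; have := ht p; lia.
have bn: b < n by apply: lt_n; rewrite hb; have := ht p; lia.
have ha': wire d' p a = t p by rewrite -ha; apply: esym; exact: eq_wire.
have hb': wire d' p b = (t p).+1 by rewrite -hb; apply: esym; exact: eq_wire.
have cr: crossing d' p a b by rewrite /crossing d'p ha' hb' !eqxx.
have: wire d' N b < wire d' N a.
  apply: (@wire_order _ p.+1) => //; first by move=> r hr; apply: red => //; lia.
  by rewrite /= d'p ha' hb'; swap_lia.
have ea: wire d N a = t p by rewrite (@wire_elbows _ p) //; lia.
have eb: wire d N b = (t p).+1 by rewrite (@wire_elbows _ p) //; lia.
move=> lt_ba; have [e|ne] := eqVneq (wire d N a) (wire d' N a).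
  by exists b => //; lia.
by exists a => //; apply/eqP.
Qed.

End Words.

(** * Reading the rectangle row by row *)

(** Row 0 of the word is the southernmost row of the rectangle, hence the
reversal of the row index. *)
Definition strand (k m p : nat) : nat := k.-1 - p %/ m + p %% m.

Lemma strand_box k m A B : B < m -> strand k m (A * m + B) = k.-1 - A + B.
Proof.
move=> hB; have m_gt0 : 0 < m by lia.
by rewrite /strand divnMDl // divn_small // modnMDl modn_small // addn0.
Qed.

Lemma ltn_box m A B A' B' : B < m -> B' < m ->
  (A * m + B < A' * m + B') = (A < A') || (A == A') && (B < B').
Proof.
move=> hB hB'; case: (ltngtP A A') => h /=.
- by apply/idP; have: A.+1 * m <= A' * m by [rewrite leq_mul2r h orbT]; rewrite mulSn; lia.
- apply/negbTE; rewrite -leqNgt.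
  by have: A'.+1 * m <= A * m by [rewrite leq_mul2r h orbT]; rewrite mulSn; lia.
- by rewrite h ltn_add2l.
Qed.

Lemma ltn_rows m A B A' : B < m -> (A * m + B < A' * m) = (A < A').
Proof. by move=> hB; rewrite -(addn0 (A' * m)) ltn_box ?ltn0 ?andbF ?orbF //; lia. Qed.

Lemma leq_rows m A B A' : B < m -> (A' * m <= A * m + B) = (A' <= A).
Proof. by move=> hB; rewrite leqNgt ltn_rows // -leqNgt. Qed.

Section Grid.

Variables k m : nat.
Hypothesis m_gt0 : 0 < m.
Implicit Types (d : nat -> bool) (p q r a b A B R j : nat).

Local Notation strand := (strand k m).
Local Notation wire := (wire strand).
Local Notation crossing := (crossing strand).

Lemma boxP (P : nat -> Prop) :
  (forall A B, B < m -> P (A * m + B)) -> forall q, P q.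
Proof. by move=> h q; rewrite (divn_eq q m); apply: h; rewrite ltn_mod. Qed.

Lemma go_east d R j j' a : R < k -> j <= j' <= m ->
  (forall c, j <= c < j' -> d (R * m + c)) ->
  wire d (R * m + j) a = k.-1 - R + j -> wire d (R * m + j') a = k.-1 - R + j'.
Proof.
move=> hR; elim: j' => [|j' IH] hj h ha; first by move: ha; have ->: j = 0 by lia.
have [<-//|hne] := eqVneq j j'.+1.
have {}IH: wire d (R * m + j') a = k.-1 - R + j'.
  by apply: IH => // [|c hc]; [lia | apply: h; lia].
rewrite addnS /= h; last lia.
by rewrite IH strand_box; [swap_lia | lia].
Qed.

(** While the word finishes row R and begins row R.+1, its letters act strictly
above, and then strictly below, the strand of the horizontal edge between the
two rows in column j. *)
Lemma wire_up d R j a : R.+1 < k -> j < m ->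
  wire d (R * m + j).+1 a = k.-1 - R + j ->
  wire d (R.+1 * m + j) a = k.-1 - R + j.
Proof.
move=> hR hj ha; rewrite -[RHS]ha; apply: wire_stay; first by rewrite mulSn; lia.
elim/boxP => A B hB /andP[h1 h2]; move: h1; rewrite ltn_box // => h1.
by move: h2; rewrite ltn_box // ha strand_box // => h2; split; lia.
Qed.

Lemma go_north d R R' j a : R <= R' < k -> j < m ->
  (forall A, R <= A < R' -> d (A * m + j)) ->
  wire d (R * m + j) a = k.-1 - R + j.+1 ->
  wire d (R' * m + j) a = k.-1 - R' + j.+1.
Proof.
move=> hR hj; elim: R' hR => [|R' IH] hR h ha; first by move: ha; have ->: R = 0 by lia.
have [<-//|hne] := eqVneq R R'.+1.
have {}IH: wire d (R' * m + j) a = k.-1 - R' + j.+1.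
  by apply: IH => // [|A hA]; [lia | apply: h; lia].
rewrite wire_up //; try lia.
rewrite /= h; last lia.
by rewrite IH strand_box //; swap_lia.
Qed.

(** After a cross in row R and column j, this separates the pipe going straight
east from the pipe that it has crossed: first within row R, then for the
remaining rows, which cannot reach the eastern end of row R. *)
Definition east_barrier R j q : nat :=
  if q < R.+1 * m then k.-1 - R + j else k.-1 - R + m.-1.

(** The strand of a pipe running straight north in column j; it drops by one at
each box of that column, which is why the columns after j are one lower. *)
Definition north_barrier j q : nat := k - q %/ m - (j < q %% m) + j.

Lemma north_barrier_box A B j : B < m ->
  north_barrier j (A * m + B) = k - A - (j < B) + j.
Proof.
move=> hB; rewrite /north_barrier divnMDl // divn_small // modnMDl modn_small //.
by rewrite addn0.
Qed.

Lemma box_next A B : B < m ->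
  (A * m + B).+1 = if B.+1 < m then A * m + B.+1 else A.+1 * m + 0.
Proof. by move=> hB; case: ltnP => h; rewrite ?mulSn; lia. Qed.

Lemma east_barrierP R j q : j < m -> R < k -> R * m + j < q -> q < k * m ->
  strand q != east_barrier R j q /\ east_barrier R j q <= east_barrier R j q.+1.
Proof.
move=> hj hR; move: q; elim/boxP => A B hB; rewrite ltn_box // ltn_rows // => h1 h2.
split; last by rewrite /east_barrier; case: ltnP => ?; case: ltnP => ?; lia.
by rewrite /east_barrier ltn_rows // strand_box //; case: ltnP; lia.
Qed.

Lemma north_barrierP R j q : j < m -> R < k -> R * m + j < q -> q < k * m ->
  strand q != north_barrier j q /\ north_barrier j q.+1 <= north_barrier j q.
Proof.
move=> hj hR; move: q; elim/boxP => A B hB; rewrite ltn_box // ltn_rows // => h1 h2.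
rewrite north_barrier_box // strand_box // box_next //; split; first lia.
by case: ltnP => h; rewrite north_barrier_box //; lia.
Qed.

Lemma north_barrier_next R j : R < k -> j < m ->
  north_barrier j (R * m + j).+1 = k.-1 - R + j.
Proof.
move=> hR hj; rewrite box_next //.
by case: (ltnP j.+1 m) => h; rewrite north_barrier_box //; lia.
Qed.

(** The Cauchon condition after the left-right reflection, in terms of the word.
*)
Definition straight_out d : Prop := forall R j, R < k -> j < m -> d (R * m + j) ->
  (forall c, j < c < m -> d (R * m + c)) \/
  (forall A, R < A < k -> d (A * m + j)).

Lemma below_east_barrier d R j q a : R < k -> j < m -> R * m + j < q <= k * m ->
  wire d (R * m + j).+1 a <= k.-1 - R + j ->
  wire d q a <= east_barrier R j q.
Proof.
move=> hR hj hq ha; apply: (@wire_below _ _ _ (R * m + j).+1); first lia.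
  by move=> r hr; apply: east_barrierP => //; lia.
by rewrite /east_barrier; case: ltnP => //; lia.
Qed.

Lemma above_north_barrier d R j q a : R < k -> j < m -> R * m + j < q <= k * m ->
  k.-1 - R + j < wire d (R * m + j).+1 a ->
  north_barrier j q < wire d q a.
Proof.
move=> hR hj hq ha; apply: (@wire_above _ _ _ (R * m + j).+1); first lia.
  by move=> r hr; apply: (@north_barrierP R) => //; lia.
by rewrite north_barrier_next.
Qed.

Lemma above_east_barrier d R j q a : R < k -> j < m -> R * m + j < q <= k * m ->
  (forall c, j <= c < m -> d (R * m + c)) ->
  wire d (R * m + j) a = k.-1 - R + j ->
  east_barrier R j q < wire d q a.
Proof.
move=> hR hj hq hd ha.
have go c : j <= c <= m -> wire d (R * m + c) a = k.-1 - R + c.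
  by move=> hc; apply: (@go_east _ _ j) => // x hx; apply: hd; lia.
rewrite /east_barrier; case: (ltnP q (R.+1 * m)) => h.
  rewrite mulSn in h; have := go (q - R * m).
  by rewrite subnKC; lia.
(* After row R, the barrier no longer moves. *)
apply: (@wire_above _ _ (fun=> k.-1 - R + m.-1) (R * m + m)).
  by rewrite mulSn in h; lia.
  elim/boxP => A B hB; rewrite addnC -mulSn leq_rows // => hr.
  have: A < k by rewrite -(ltn_rows _ _ hB); lia.
  by rewrite strand_box //; lia.
by rewrite go; lia.
Qed.

Lemma on_north_barrier d R j q a : R < k -> j < m -> R * m + j < q <= k * m ->
  (forall A, R <= A < k -> d (A * m + j)) ->
  wire d (R * m + j) a = (k.-1 - R + j).+1 ->
  wire d q a = north_barrier j q.
Proof.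
move=> hR hj hq hd ha.
elim: q hq => [|q IH]; first lia.
move=> hq; have [->|hne] := eqVneq q (R * m + j).
  rewrite north_barrier_next //= hd ?ha ?strand_box //; last lia.
  by swap_lia.
have {}IH := IH ltac:(lia).
move: q IH hq hne; elim/boxP => A B hB IH /andP[h1 h2] hne.
have {}h1: R * m + j < A * m + B by lia.
move: h1 h2; rewrite ltn_box // ltn_rows // => h1 h2.
rewrite [LHS]/= IH strand_box // north_barrier_box //.
have [e|neB] := eqVneq B j.
  rewrite e north_barrier_next ?hd //; try lia.
  by swap_lia.
have ->: north_barrier j (A * m + B).+1 = k - A - (j < B) + j.
  rewrite box_next //.
  by case: (ltnP B.+1 m) => h; rewrite north_barrier_box //; lia.
by case: (d _) => //; swap_lia.
Qed.

(** The barrier along the straight pipe lies between a and b at every later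
letter, and no later letter acts across it. *)
Lemma straight_out_crosses_once d p q a b : straight_out d -> p < q < k * m ->
  crossing d p a b -> ~~ crossing d q a b.
Proof.
move=> gd; move: p; elim/boxP => R j hj hq.
(* Up to exchanging a and b, the pipe a enters p from the west. *)
wlog [ha hb] : a b / wire d (R * m + j) a = strand (R * m + j) /\
                    wire d (R * m + j) b = (strand (R * m + j)).+1.
  move=> H /[dup] /andP[dp /orP[/andP[/eqP ? /eqP ?]|/andP[/eqP ? /eqP ?]]] h;
  first exact: H.
  rewrite /crossing orbC; apply: H => //.
  by move: h; rewrite /crossing orbC.
move=> /andP[dp _].
have hR: R < k by rewrite -(ltn_rows _ _ hj); lia.
move: ha hb; rewrite strand_box // => ha hb.
have aS: wire d (R * m + j).+1 a = (k.-1 - R + j).+1.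
  by rewrite /= dp ha strand_box //; swap_lia.
have bS: wire d (R * m + j).+1 b = k.-1 - R + j.
  by rewrite /= dp hb strand_box //; swap_lia.
suff [th ne [lb la]] : exists2 th, strand q != th & wire d q b <= th /\ th < wire d q a.
  by apply/negP => /andP[_]; lia.
have [hE|hN] := gd R j hR hj dp.
- exists (east_barrier R j q); first by case: (@east_barrierP R j q) => //; lia.
  split; first by apply: below_east_barrier => //; lia.
  apply: above_east_barrier => //; first lia.
  by move=> c hc; have [->//|?] := eqVneq c j; apply: hE; lia.
- exists (north_barrier j q); first by case: (@north_barrierP R j q) => //; lia.
  split; last by apply: (@above_north_barrier d R) => //; lia.
  rewrite (@on_north_barrier d R j) //; first lia.
  by move=> c hc; have [->//|?] := eqVneq c R; apply: hN; lia.
Qed.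

(** The barrier at the end of the word separates the exit of the straight pipe
of d from the exit of the same pipe in d', where it has turned at p. *)
Lemma straight_out_cross_forced d d' p : straight_out d -> p < k * m ->
  (forall r, r < p -> d r = d' r) -> d p ->
  (forall a, a < k + m -> wire d (k * m) a = wire d' (k * m) a) -> d' p.
Proof.
move=> gd; move: p; elim/boxP => R j hj; rewrite ltn_rows // => hR dd' dp same.
apply/negPn/negP => ndp.
have hN: R * m + j < k * m <= k * m by rewrite ltn_rows // hR leqnn.
have lt_n a : wire d (R * m + j) a < k + m -> a < k + m.
  move=> ha; apply/negPn/negP; rewrite -leqNgt => h.
  have : (k + m).-1 < wire d (R * m + j) a; last lia.
  apply: (@wire_above _ _ (fun=> (k + m).-1) 0) => //=; last lia.
  elim/boxP => A B hB hr.
  have: A < k by rewrite -(ltn_rows _ _ hB); lia.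
  by rewrite strand_box //; lia.
have [hE|hNo] := gd R j hR hj dp.
- have [a ha] := wire_surj strand d (R * m + j) (k.-1 - R + j).
  have := @above_east_barrier d R j (k * m) a hR hj hN.
  have := @below_east_barrier d' R j (k * m) a hR hj hN.
  rewrite -same; last by apply: lt_n; lia.
  rewrite [wire d' _.+1 _]/= (negbTE ndp) -(eq_wire _ dd') ha => /(_ (leqnn _)).
  move=> h1 h2; suff: east_barrier R j (k * m) < wire d (k * m) a by lia.
  by apply: h2 => // c hc; have [->//|?] := eqVneq c j; apply: hE; lia.
- have [a ha] := wire_surj strand d (R * m + j) (k.-1 - R + j).+1.
  have := @on_north_barrier d R j (k * m) a hR hj hN.
  have := @above_north_barrier d' R j (k * m) a hR hj hN.
  rewrite -same; last by apply: lt_n; lia.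
  rewrite [wire d' _.+1 _]/= (negbTE ndp) -(eq_wire _ dd') ha => /(_ (leqnn _)).
  move=> h1 h2; suff: wire d (k * m) a = north_barrier j (k * m) by lia.
  by apply: h2 => // c hc; have [->//|?] := eqVneq c R; apply: hNo; lia.
Qed.

(** A cross with an elbow to its east and an elbow to its north is turned into a
rectangle whose sides consist of crosses, apart from the north-west and
south-east corners, which are elbows.  The north-east corner is arbitrary.
This is obtained by choosing R' lowest, then R highest below it, then j'
westernmost, and then j easternmost. *)
Lemma kiss_rectangle d R0 R1 j0 j1 : R0 < R1 < k -> j0 < j1 < m ->
  d (R0 * m + j0) -> ~~ d (R0 * m + j1) -> ~~ d (R1 * m + j0) ->
  exists R R' j j',
    [/\ R < R' < k, j < j' < m,
        [/\ forall c, j <= c < j' -> d (R * m + c),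
           forall A, R < A < R' -> d (A * m + j) &
           forall A, R < A < R' -> d (A * m + j')] ,
        forall c, j < c < j' -> d (R' * m + c) &
        ~~ d (R * m + j') /\ ~~ d (R' * m + j)].
Proof.
move=> hR hj d00 d01 d10.
have exR: exists A, (R0 < A) && ~~ d (A * m + j0) by exists R1; rewrite d10; lia.
case: (ex_minnP exR) => R' /andP[R0R' dR'] minR'.
have R'k: R' < k by have := minR' R1; rewrite d10 andbT; lia.
pose P A := [&& R0 <= A, A < R' & [exists c : 'I_m, (j0 < c) && ~~ d (A * m + c)]].
have exP: exists A, P A.
  exists R0; apply/and3P; split => //.
  by apply/existsP; exists (Ordinal (proj2 (andP hj))); rewrite d01 /=; lia.
have boundP A: P A -> A <= R' by case/and3P; lia.
case: (ex_maxnP exP boundP) => R /and3P[R0R RR' /existsP[c0 /andP[j0c0 dc0]]] maxR.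
have exj: exists c, (j0 < c) && ~~ d (R * m + c) by exists c0; rewrite j0c0.
case: (ex_minnP exj) => j' /andP[j0j' dj'] minj'.
have j'm: j' < m by have := minj' c0; rewrite j0c0 dc0 /=; have := ltn_ord c0; lia.
have exq: exists c, [&& j0 <= c, c < j' & ~~ d (R' * m + c)].
  by exists j0; rewrite leqnn j0j'.
have boundq c : [&& j0 <= c, c < j' & ~~ d (R' * m + c)] -> c <= j' by case/and3P; lia.
case: (ex_maxnP exq boundq) => j /and3P[j0j jj' dj] maxj.
have cross_col A : R0 <= A < R' -> d (A * m + j0).
  move=> hA; have [->//|ne] := eqVneq A R0.
  by apply/negPn/negP => h; have := minR' A; rewrite h andbT; lia.
have full A c : R < A < R' -> j0 <= c < m -> d (A * m + c).
  move=> hA hc; have [->|ne] := eqVneq c j0; first by apply: cross_col; lia.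
  apply/negPn/negP => h; suff: A <= R by lia.
  apply: maxR; apply/and3P; split; [lia|lia|].
  by apply/existsP; exists (Ordinal (proj2 (andP hc))); rewrite h /=; lia.
exists R, R', j, j'; split => //; try lia.
- split => [c hc|A hA|A hA]; try by apply: full; lia.
  have [->|ne] := eqVneq c j0; first by apply: cross_col; lia.
  by apply/negPn/negP => h; have := minj' c; rewrite h andbT; lia.
- by move=> c hc; apply/negPn/negP => h; have := maxj c; rewrite h andbT; lia.
Qed.

(** The pipes crossed at the south-west corner of such a rectangle follow its
two halves and meet at the north-east corner. *)
Lemma pipes_kiss d R R' j j' a b :
  R < R' < k -> j < j' < m ->
  (forall c, j <= c < j' -> d (R * m + c)) ->
  (forall A, R < A < R' -> d (A * m + j)) ->
  (forall A, R < A < R' -> d (A * m + j')) ->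
  (forall c, j < c < j' -> d (R' * m + c)) ->
  ~~ d (R * m + j') -> ~~ d (R' * m + j) ->
  wire d (R * m + j) a = strand (R * m + j) ->
  wire d (R * m + j) b = (strand (R * m + j)).+1 ->
  wire d (R' * m + j') a = (strand (R' * m + j')).+1 /\
  wire d (R' * m + j') b = strand (R' * m + j').
Proof.
move=> hR hj r1 c1 c2 r2 e1 e2; rewrite !strand_box; try lia.
move=> ha hb; split.
  have := @go_east d R j j' a ltac:(lia) ltac:(lia) r1 ha => {}ha.
  have := @wire_up d R j' a ltac:(lia) ltac:(lia).
  rewrite /= (negbTE e1) => /(_ ha) {}ha.
  rewrite -addnS; apply: (@go_north _ R.+1); try lia.
  by move=> A hA; apply: c2; lia.
have {}hb: wire d (R' * m + j) b = k.-1 - R' + j.+1.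
  apply: (@go_north _ R); try lia.
  by move=> A hA; have [->|?] := eqVneq A R; [apply: r1|apply: c1]; lia.
apply: (@go_east _ _ j.+1); try lia; first by move=> c hc; apply: r2; lia.
by rewrite addnS /= (negbTE e2).
Qed.

(** Exclusive or: both tiles are changed, whatever the second one is, so a
second meeting that is a cross becomes an elbow. *)
Definition flip p q d r : bool := d r (+) ((r == p) || (r == q)).

Lemma flip_same_perm d : ~ straight_out d -> exists p q,
  [/\ p < q < k * m, d p & forall a, wire (flip p q d) (k * m) a = wire d (k * m) a].
Proof.
move=> bad.
have [R0 [R1 [j0 [j1 [hR0 hj0 [d00 [d01 d10]]]]]]] : exists R0 R1 j0 j1,
    [/\ R0 < R1 < k, j0 < j1 < m & d (R0 * m + j0) /\
        (~~ d (R0 * m + j1) /\ ~~ d (R1 * m + j0))].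
  pose bad_at (x : 'I_k * 'I_m) := [&& d (x.1 * m + x.2),
     [exists c : 'I_m, (x.2 < c) && ~~ d (x.1 * m + c)] &
     [exists A : 'I_k, (x.1 < A) && ~~ d (A * m + x.2)]].
  have [x /and3P[h0 /existsP[c /andP[h1 h2]] /existsP[A /andP[h3 h4]]]|none] := pickP bad_at.
    by exists x.1, A, x.2, c; rewrite h1 h3 !ltn_ord.
  case: bad => R j hR hj dR.
  have := none (Ordinal hR, Ordinal hj); rewrite /bad_at /= dR /=.
  move=> /negbT; rewrite negb_and => /orP[] /existsPn h; [left => c hc|right => A hA].
    by have := h (Ordinal (proj2 (andP hc))); rewrite /= negb_and negbK; lia.
  by have := h (Ordinal (proj2 (andP hA))); rewrite /= negb_and negbK; lia.
have [R [R' [j [j' [hR hj [r1 c1 c2] r2 [e1 e2]]]]]] := kiss_rectangle hR0 hj0 d00 d01 d10.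
have [a ha] := wire_surj strand d (R * m + j) (strand (R * m + j)).
have [b hb] := wire_surj strand d (R * m + j) (strand (R * m + j)).+1.
have [qa qb] := pipes_kiss hR hj r1 c1 c2 r2 e1 e2 ha hb.
have pq: R * m + j < R' * m + j' by rewrite ltn_box; lia.
have qN: R' * m + j' < k * m by rewrite ltn_rows; lia.
have dp: d (R * m + j) by apply: r1; lia.
exists (R * m + j), (R' * m + j'); split; rewrite ?pq //.
move=> c; apply: (wire_flip pq dp _ _ _ ha hb qa qb) => //.
- by rewrite /flip dp eqxx.
- by rewrite /flip eqxx orbT addbT.
- by move=> r h1 h2; rewrite /flip (negbTE h1) (negbTE h2) addbF.
Qed.

(** A cross counts the more, the earlier it is, so removing a cross outweighs
inserting a later one. *)
Definition weight d : nat := \sum_(r < k * m) d r * (k * m - r).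

Lemma weight_flip_lt d p q : p < q < k * m -> d p -> weight (flip p q d) < weight d.
Proof.
move=> /andP[pq qN] dp; have pN := ltn_trans pq qN.
have neqp: Ordinal qN != Ordinal pN by rewrite -val_eqE /=; lia.
rewrite /weight (bigD1 (Ordinal pN)) //= (bigD1 (Ordinal qN)) //=.
rewrite [ltnRHS](bigD1 (Ordinal pN)) //= [in ltnRHS](bigD1 (Ordinal qN)) //=.
rewrite {1 2}/flip dp !eqxx orbT /= addbT.
rewrite (eq_bigr (fun r : 'I__ => d r * (k * m - r))).
  set S := \sum_(_ < _ | _) _; case: (d q) => /=; lia.
move=> r /andP[h1 h2]; rewrite /flip.
by move: h1 h2; rewrite -!val_eqE /= => /negbTE-> /negbTE->; rewrite addbF.
Qed.

End Grid.

(** * Pipes as wires *)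

Section Pipes.

Variables k m : nat.
Hypothesis m_gt0 : 0 < m.
Implicit Types (D : filling k m) (x : 'I_k * 'I_m) (e : edge k m).

(** The word of a filling, with elbows at the numbers that are not positions. *)
Definition cross D p : bool :=
  [exists x : 'I_k * 'I_m, D x.1 x.2 && (position x == p)].

Local Notation wire := (wire (strand k m)).

Lemma position_inj : injective (@position k m).
Proof.
move=> [i j] [i' j']; rewrite /position /= => h.
have:= ltn_box (k - i.+1) (k - i'.+1) (ltn_ord j) (ltn_ord j').
have:= ltn_box (k - i'.+1) (k - i.+1) (ltn_ord j') (ltn_ord j).
rewrite h ltnn => h1 h2; congr pair; apply: val_inj => /=;
  by have := ltn_ord i; have := ltn_ord i'; lia.
Qed.

Lemma ltn_position x : position x < k * m.
Proof. by rewrite /position ltn_rows //; have := ltn_ord x.1; lia. Qed.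

Lemma strand_position x : strand k m (position x) = x.1 + x.2.
Proof. by rewrite /position strand_box //; have := ltn_ord x.1; lia. Qed.

Lemma box_of_row R (j : 'I_m) : R < k ->
  exists x : 'I_k * 'I_m, position x = R * m + j.
Proof.
move=> hR; have h : k - R.+1 < k by lia.
exists (Ordinal h, j); rewrite /position /=; congr (_ * _ + _); lia.
Qed.

Lemma position_surj p : p < k * m -> exists x, position x = p.
Proof.
move: p; apply: (boxP m_gt0) => A B hB; rewrite ltn_rows // => hA.
by have [x <-] := box_of_row (Ordinal hB) hA; exists x.
Qed.

Lemma crossE D x : cross D (position x) = D x.1 x.2.
Proof.
apply/existsP/idP => [[y /andP[dy /eqP /position_inj <-]]//|dx].
by exists x; rewrite dx eqxx.
Qed.

Lemma cross_matrix (d : nat -> bool) p : p < k * m ->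
  cross (\matrix_(i, j) d (position (i, j)))%R p = d p.
Proof. by move=> /position_surj[[i j] <-]; rewrite crossE mxE. Qed.

Definition edge_strand e : nat :=
  match e with inl (i, c) => i + c | inr (r, j) => r + j end.

(** An edge is alive from just after the letter of the box on its west or south
side until the letter of the box on its east or north side, and during this time no letter acts on its strand
([live_strand]).  This relates pipes, which advance box by box, to the word,
where all pipes advance together. *)
Definition birth e : nat :=
  match e with
  | inl (i, c) => if c == ord0 then 0 else (k - i.+1) * m + c
  | inr (r, j) => if r == ord_max then 0 else ((k - r.+1) * m + j).+1
  end.

Definition death e : nat :=
  match e with
  | inl (i, c) => if c == ord_max then k * m else (k - i.+1) * m + c
  | inr (r, j) => if r == ord0 then k * m else (k - r) * m + j
  end.

Definition is_exit e : bool :=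
  match e with inl (_, c) => c == ord_max | inr (r, _) => r == ord0 end.

Lemma edge_cases e :
  [\/ exists x, e = west x.1 x.2, exists x, e = south x.1 x.2 | is_exit e].
Proof.
case: e => [[i c]|[r j]].
  by case: (unliftP ord_max c) => [j ->|->];
    [constructor 1; exists (i, j) | constructor 3; rewrite /= eqxx].
by case: (unliftP ord0 r) => [i ->|->];
  [constructor 2; exists (i, j) | constructor 3; rewrite /= eqxx].
Qed.

Lemma next_west D x : next_edge D (west x.1 x.2) =
  if D x.1 x.2 then east x.1 x.2 else north x.1 x.2.
Proof. by rewrite /= liftK. Qed.

Lemma next_south D x : next_edge D (south x.1 x.2) =
  if D x.1 x.2 then north x.1 x.2 else east x.1 x.2.
Proof. by rewrite /= liftK. Qed.

Lemma next_exit D e : is_exit e -> next_edge D e = e.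
Proof. by case: e => [[i c]|[r j]] /= /eqP->; rewrite unlift_none. Qed.

Lemma box_edges x :
  [/\ edge_strand (west x.1 x.2) = x.1 + x.2,
      edge_strand (south x.1 x.2) = (x.1 + x.2).+1,
      edge_strand (north x.1 x.2) = x.1 + x.2 &
      edge_strand (east x.1 x.2) = (x.1 + x.2).+1] /\
  [/\ death (west x.1 x.2) = position x,
      death (south x.1 x.2) = position x,
      birth (north x.1 x.2) = (position x).+1 &
      birth (east x.1 x.2) = (position x).+1].
Proof.
case: x => i j; rewrite /position /=; split; split => //=.
- by rewrite /bump leqNgt ltn_ord.
- by rewrite /bump leqNgt ltn_ord.
- by rewrite /bump /=; lia.
- by rewrite -val_eqE /= /bump leqNgt ltn_ord /=; have := ltn_ord j; case: eqP; lia.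
- by rewrite -val_eqE /= /bump leqNgt ltn_ord /=; have := ltn_ord i; case: eqP; lia.
- by rewrite /bump /=; lia.
Qed.

Lemma live_strand e r : birth e <= r < death e ->
  strand k m r != edge_strand e /\ (strand k m r).+1 != edge_strand e.
Proof.
move: r; apply: (boxP m_gt0) => A B hB; rewrite strand_box //.
case: e => [[i c]|[r j]] /=; rewrite -!val_eqE /=.
  have := ltn_ord i; have := ltn_ord c.
  case: (eqVneq (c : nat) 0) => [->|c0]; case: (eqVneq _ m) => [e|cm] hc hi.
  - by move: m_gt0; rewrite -e.
  - by rewrite addn0 ltn_rows //; lia.
  - rewrite e addnC -mulSn leq_rows // ltn_rows //; lia.
  - by lia.
have := ltn_ord r; have jm := ltn_ord j.
case: (eqVneq (r : nat) k) => [->|rk]; case: (eqVneq _ 0) => [e|r0] hr.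
- by rewrite ltn_rows //; lia.
- by rewrite ltn_box //; lia.
- by rewrite ltn_box // ltn_rows //; lia.
- by rewrite !ltn_box //; lia.
Qed.

Lemma wire_live D a e p : birth e <= p <= death e ->
  wire (cross D) (birth e) a = edge_strand e ->
  wire (cross D) p a = edge_strand e.
Proof.
move=> hp ha; rewrite -[RHS]ha; apply: wire_stay => [|r hr]; first lia.
by rewrite ha; apply: live_strand; lia.
Qed.

Lemma entry_birth (a : 'I_(k + m)) : birth (entry a) = 0.
Proof. by rewrite /entry; case: splitP => j _ /=; rewrite ?eqxx. Qed.

Lemma entry_strand (a : 'I_(k + m)) : edge_strand (entry a) = a.
Proof. by rewrite /entry; case: splitP => j -> /=; rewrite ?addn0. Qed.

Lemma birth_le_death e : birth e <= death e.
Proof.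
case: e => [[i c]|[r j]] /=; rewrite -!val_eqE /=.
  have := ltn_ord i; have := ltn_ord c.
  case: (eqVneq (c : nat) 0) => [//|c0]; case: (eqVneq _ m) => [e|//] hc hi.
  by rewrite e addnC -mulSn leq_mul2r; lia.
have := ltn_ord r; have jm := ltn_ord j.
case: (eqVneq (r : nat) k) => [//|rk]; case: (eqVneq _ 0) => [e|r0] hr.
  by rewrite ltn_rows //; lia.
by rewrite ltn_box //; lia.
Qed.

Lemma on_pipe_wire D (a : 'I_(k + m)) e p : on_pipe D a e ->
  birth e <= p <= death e -> wire (cross D) p a = edge_strand e.
Proof.
rewrite /on_pipe => /iter_findex <-.
elim: (findex _ _ _) p => [|n IH] p.
  by move=> hp; apply: wire_live => //; rewrite entry_birth entry_strand.
rewrite iterS; case: (edge_cases (iter n (next_edge D) (entry a)));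
  last by move=> /(@next_exit D) ->; exact: IH.
- case=> x ex hp; apply: wire_live => // {hp}; rewrite ex in IH *.
  have [[s1 s2 s3 s4] [d1 d2 b1 b2]] := box_edges x.
  have h : wire (cross D) (position x) a = x.1 + x.2.
    by rewrite -s1; apply: IH; rewrite -d1 birth_le_death leqnn.
  rewrite next_west; have := crossE D x; case: (D _ _) => hx;
  by rewrite ?s3 ?s4 ?b1 ?b2 /= hx h ?strand_position; swap_lia.
- case=> x ex hp; apply: wire_live => // {hp}; rewrite ex in IH *.
  have [[s1 s2 s3 s4] [d1 d2 b1 b2]] := box_edges x.
  have h : wire (cross D) (position x) a = (x.1 + x.2).+1.
    by rewrite -s2; apply: IH; rewrite -d2 birth_le_death leqnn.
  rewrite next_south; have := crossE D x; case: (D _ _) => hx;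
  by rewrite ?s3 ?s4 ?b1 ?b2 /= hx h ?strand_position; swap_lia.
Qed.

Lemma on_pipe_next D (a : 'I_(k + m)) e :
  on_pipe D a e -> on_pipe D a (next_edge D e).
Proof. by move=> h; apply: connect_trans h (fconnect1 _ _). Qed.

Lemma edge_origin D e :
  (exists a, e = entry a) \/ exists2 e', e = next_edge D e' & birth e' < birth e.
Proof.
have bw x : birth (west x.1 x.2) < (position x).+1.
  by rewrite ltnS; have [_ [<- _ _ _]] := box_edges x; apply: birth_le_death.
have bs x : birth (south x.1 x.2) < (position x).+1.
  by rewrite ltnS; have [_ [_ <- _ _]] := box_edges x; apply: birth_le_death.
case: e => [[i c]|[r j]].
  case: (unliftP ord0 c) => [j ->|->]; last first.
    by left; exists (lshift m i); rewrite /entry -[lshift _ _]/(unsplit (inl i)) unsplitK.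
  pose x := (i, j); have [_ [_ _ _ b]] := box_edges x.
  right; case dx: (D i j).
    by exists (west x.1 x.2); [rewrite next_west dx | rewrite [ltnRHS]b].
  by exists (south x.1 x.2); [rewrite next_south dx | rewrite [ltnRHS]b].
case: (unliftP ord_max r) => [i ->|->]; last first.
  by left; exists (rshift k j); rewrite /entry -[rshift _ _]/(unsplit (inr j)) unsplitK.
pose x := (i, j); have [_ [_ _ b _]] := box_edges x.
right; case dx: (D i j).
  by exists (south x.1 x.2); [rewrite next_south dx | rewrite [ltnRHS]b].
by exists (west x.1 x.2); [rewrite next_west dx | rewrite [ltnRHS]b].
Qed.

(** Following a pipe backwards must end at an entry, as births decrease. *)
Lemma on_some_pipe D e : exists a, on_pipe D a e.
Proof.
have [n] := ubnP (birth e); elim: n e => // n IH e hn.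
have [[a ->]|[e' ee lt]] := edge_origin D e; first by exists a; apply: connect0.
by have [|a ha] := IH e'; [lia | exists a; rewrite ee; apply: on_pipe_next].
Qed.

(** Some pipe passes through e and is on the strand of e at that time; wires are
injective, so it is the only pipe on this strand. *)
Lemma on_pipeE D (a : 'I_(k + m)) e :
  on_pipe D a e = (wire (cross D) (death e) a == edge_strand e).
Proof.
have h b : on_pipe D b e -> wire (cross D) (death e) b = edge_strand e.
  by move=> hb; apply: on_pipe_wire; rewrite ?birth_le_death ?leqnn.
apply/idP/eqP => [/h //|ha].
have [b hb] := on_some_pipe D e; suff -> : a = b by [].
by apply/val_inj/(@wire_inj (strand k m) (cross D) (death e)); rewrite ha h.
Qed.

Lemma crossings_wire D (a b : 'I_(k + m)) x :
  (x \in crossings D a b) = crossing (strand k m) (cross D) (position x) a b.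
Proof.
have [[s1 s2 _ _] [d1 d2 _ _]] := box_edges x.
by rewrite inE !on_pipeE d1 d2 s1 s2 /crossing crossE strand_position.
Qed.

Definition word_reduced D : Prop := forall a b p q, a < k + m -> b < k + m ->
  p < q < k * m -> crossing (strand k m) (cross D) p a b ->
  ~~ crossing (strand k m) (cross D) q a b.

Lemma reducedP D : reduced D <-> word_reduced D.
Proof.
split=> [|red].
  move=> /forallP red a b p q ha hb /andP[pq qN] ca; apply/negP => cb.
  have [x ex] := position_surj (ltn_trans pq qN).
  have [y ey] := position_surj qN.
  have ab : Ordinal ha != Ordinal hb.
    by apply/eqP => -[e]; move: ca; rewrite /crossing e; lia.
  have /implyP/(_ ab) := forallP (red (Ordinal ha)) (Ordinal hb).
  move=> /card_le1_eqP /(_ x y); rewrite !crossings_wire ex ey => /(_ ca cb) e.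
  by move: ey; rewrite e ex; lia.
apply/forallP => a; apply/forallP => b; apply/implyP => ab.
apply/card_le1_eqP => x y; rewrite !crossings_wire => ca cb.
apply: position_inj; case: (ltngtP (position x) (position y)) => // h.
  exfalso; move: cb; apply/negP; apply: red ca => //.
  by rewrite h ltn_position.
exfalso; move: ca; apply/negP; apply: red cb => //.
by rewrite h ltn_position.
Qed.

(** The distance to the north-east corner, counted in antidiagonals. *)
Definition steps_left e : nat :=
  match e with inl (i, c) => i + (m - c) | inr (r, j) => r + (m - j.+1) end.

Lemma steps_left_box x :
  [/\ steps_left (west x.1 x.2) = (x.1 + (m - x.2.+1)).+1,
      steps_left (south x.1 x.2) = (x.1 + (m - x.2.+1)).+1,
      steps_left (north x.1 x.2) = x.1 + (m - x.2.+1) &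
      steps_left (east x.1 x.2) = x.1 + (m - x.2.+1)].
Proof.
case: x => i j /=; have hi := ltn_ord i; have hj := ltn_ord j.
by rewrite /bump /= (leqNgt k) hi (leqNgt m) hj /=; split; lia.
Qed.

Lemma exit_reached D (a : 'I_(k + m)) :
  is_exit (iter (k + m) (next_edge D) (entry a)).
Proof.
have h n : is_exit (iter n (next_edge D) (entry a)) \/
    steps_left (iter n (next_edge D) (entry a)) + n < k + m.
  elim: n => [|n IH].
    right; rewrite /= addn0 /entry; case: splitP => j _ /=; have := ltn_ord j; lia.
  rewrite iterS; case: (edge_cases (iter n (next_edge D) (entry a))).
  - case=> x ex; case: IH; rewrite ex.
      by rewrite /= -val_eqE /= /bump; case: (x.2) => j hj /=; lia.
    move=> IH; right; have [s1 s2 s3 s4] := steps_left_box x.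
    by move: IH; rewrite next_west s1; case: (D _ _); rewrite ?s3 ?s4; lia.
  - case=> x ex; case: IH; rewrite ex //.
    move=> IH; right; have [s1 s2 s3 s4] := steps_left_box x.
    by move: IH; rewrite next_south s2; case: (D _ _); rewrite ?s3 ?s4; lia.
  - by move=> /[dup] /(@next_exit D)->; left.
have [//|] := h (k + m); first by rewrite ltnNge leq_addl.
Qed.

Lemma pipe_exit_wire D (a : 'I_(k + m)) :
  pipe_exit D a = k + (wire (cross D) (k * m) a).+1.
Proof.
rewrite /pipe_exit; set e := iter _ _ _.
have ee : is_exit e := exit_reached D a.
have de : death e = k * m by move: ee; case: (e) => [[i c]|[r j]] /= ->.
have /eqP : wire (cross D) (death e) a == edge_strand e.
  by rewrite -on_pipeE; apply: fconnect_iter.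
rewrite de => ->; move: ee; case: (e) => [[i c]|[r j]] /= /eqP-> /=; lia.
Qed.

Lemma eq_affine_perm D D' : affine_perm D =1 affine_perm D' <->
  forall a, a < k + m -> wire (cross D) (k * m) a = wire (cross D') (k * m) a.
Proof.
split=> h.
  move=> a ha; have := h (Posz a.+1); rewrite /affine_perm.
  have -> : (Posz a.+1 - 1)%R = Posz a by rewrite -addn1 PoszD GRing.addrK.
  rewrite modz_nat divz_nat modn_small // divn_small //=.
  rewrite (insubT (fun i => i < k + m) ha) /= !pipe_exit_wire /=; lia.
move=> x; rewrite /affine_perm; case: insubP => // i _ _.
by rewrite !pipe_exit_wire h.
Qed.

End Pipes.

(** * Bottom pipe dreams are the reflected Cauchon diagrams *)

Section Bottom.

Variables k m : nat.
Hypothesis m_gt0 : 0 < m.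
Implicit Types (D : filling k m) (d : nat -> bool).

Local Notation wire := (wire (strand k m)).

Definition mirror (C : 'M[bool]_(k, m)) : 'M[bool]_(k, m) :=
  (\matrix_(i, j) C i (rev_ord j))%R.

Lemma mirrorK : involutive mirror.
Proof. by move=> C; apply/matrixP => i j; rewrite !mxE rev_ordK. Qed.

Lemma cross_rev D (i : 'I_k) (c : 'I_m) : cross D (rev_ord i * m + c) = D i c.
Proof. exact: (crossE m_gt0 D (i, c)). Qed.

Lemma cross_box D R c (hR : R < k) (hc : c < m) :
  cross D (R * m + c) = D (rev_ord (Ordinal hR)) (Ordinal hc).
Proof. by rewrite -cross_rev rev_ordK. Qed.

Lemma straight_outP D : reflect (straight_out k m (cross D)) (cauchon (mirror D)).
Proof.
apply: (iffP idP) => [|g].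
  move=> /forallP cau R c hR hc; rewrite (cross_box _ hR hc) => dR.
  have /forallP/(_ (rev_ord (Ordinal hc))) := cau (rev_ord (Ordinal hR)).
  rewrite mxE rev_ordK dR => /orP[] /forallP h; [left => c' hc'|right => A hA].
    have hc'm : c' < m by lia.
    have := h (rev_ord (Ordinal hc'm)); rewrite mxE rev_ordK (cross_box _ hR hc'm) /=.
    by move/implyP; apply; lia.
  have hAk : A < k by lia.
  have := h (rev_ord (Ordinal hAk)); rewrite mxE rev_ordK (cross_box _ hAk hc) /=.
  by move/implyP; apply; lia.
apply/forallP => i; apply/forallP => j; apply/implyP; rewrite mxE => dij.
have := g (rev_ord i) (rev_ord j) (ltn_ord _) (ltn_ord _).
rewrite cross_rev => /(_ dij) [] h; apply/orP; [left|right]; apply/forallP => l;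
  apply/implyP => hl; rewrite mxE -cross_rev; apply: h; rewrite ltn_ord andbT /=.
- by have := ltn_ord l; have := ltn_ord j; lia.
- by have := ltn_ord l; have := ltn_ord i; lia.
Qed.

Lemma cross_positionsE D : cross_positions D = [seq p <- iota 0 (k * m) | cross D p].
Proof.
apply: (irr_sorted_eq ltn_trans ltnn).
- rewrite ltn_sorted_uniq_leq sort_uniq (sort_sorted leq_total) andbT.
  by rewrite map_inj_uniq ?enum_uniq //; apply: position_inj.
- by apply: sorted_filter (iota_ltn_sorted _ _); apply: ltn_trans.
move=> p; rewrite mem_sort mem_filter mem_iota /=.
apply/mapP/andP => [[x + ->]|[dp /(position_surj m_gt0)[x ex]]].
  by rewrite mem_enum inE -(crossE m_gt0) ltn_position.
by exists x => //; rewrite mem_enum inE -(crossE m_gt0) ex.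
Qed.

(** The later element q matters: without it, the right-hand list could be a
proper prefix of the left-hand one. *)
Lemma filter_lexi d d' p q n : p < q < n -> (forall r, r < p -> d r = d' r) ->
  d' p -> ~~ d p -> d q ->
  ([seq r <- iota 0 n | d' r] <= [seq r <- iota 0 n | d r] :> seqlexi nat)%O.
Proof.
move=> hpq dd' d'p dp dq.
have -> : n = p + (n - p.+1).+1 by lia.
rewrite iotaD !filter_cat /= d'p (negbTE dp).
have -> : [seq r <- iota 0 p | d' r] = [seq r <- iota 0 p | d r].
  by apply: eq_in_filter => r; rewrite mem_iota => hr; rewrite dd' //; lia.
rewrite add0n; elim: [seq r <- iota 0 p | d r] => [|x s IH];
  last by rewrite !cat_cons eqhead_lexiE.
have memE y : y \in [seq r <- iota p.+1 (n - p.+1) | d r] -> p < y.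
  by rewrite mem_filter mem_iota => /and3P[].
have: q \in [seq r <- iota p.+1 (n - p.+1) | d r].
  by rewrite mem_filter dq mem_iota; lia.
case: [seq r <- iota p.+1 _ | d r] memE => [//|y s] memE _.
have py : p < y by apply: memE; rewrite mem_head.
rewrite lexi_cons; apply/andP; split; first exact: ltnW.
by rewrite leEnat leqNgt py.
Qed.

Lemma straight_out_exists D : exists D' : filling k m,
  straight_out k m (cross D') /\ affine_perm D' =1 affine_perm D.
Proof.
have [n] := ubnP (weight k m (cross D)); elim: n D => // n IH D hn.
have [g|bad] := straight_outP D; first by exists D.
have [p [q [hpq dp same]]] := flip_same_perm m_gt0 bad.
pose D1 : filling k m := (\matrix_(i, j) flip p q (cross D) (position (i, j)))%R.
have D1E r : r < k * m -> cross D1 r = flip p q (cross D) r by exact: cross_matrix.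
have [|D' [gD' eD']] := IH D1.
  have -> : weight k m (cross D1) = weight k m (flip p q (cross D)).
    by apply: eq_bigr => r _; rewrite D1E.
  by have := weight_flip_lt m_gt0 hpq dp; lia.
exists D'; split=> // x; rewrite eD'; move: x; apply/(eq_affine_perm m_gt0) => a _.
by rewrite -same; apply: eq_wire.
Qed.

Lemma straight_out_reduced D : straight_out k m (cross D) -> reduced D.
Proof.
move=> g; apply/(reducedP m_gt0) => a b p q _ _.
exact: straight_out_crosses_once.
Qed.

Lemma straight_out_max D D' : straight_out k m (cross D) -> reduced D' ->
  affine_perm D' =1 affine_perm D ->
  (cross_positions D' <= cross_positions D)%O.
Proof.
move=> g /(reducedP m_gt0) red /(eq_affine_perm m_gt0) same.
rewrite !cross_positionsE.
have [/existsP exP|/existsPn agree] :=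
    boolP [exists r : 'I_(k * m), cross D r != cross D' r]; last first.
  suff -> : [seq p <- iota 0 (k * m) | cross D' p]
          = [seq p <- iota 0 (k * m) | cross D p] by [].
  apply: eq_in_filter => r; rewrite mem_iota => hr.
  by have := agree (Ordinal (proj2 (andP hr))); rewrite negbK => /eqP.
have {}exP : exists r, (r < k * m) && (cross D r != cross D' r).
  by case: exP => r hr; exists r; rewrite ltn_ord.
case: (ex_minnP exP) => p /andP[pN ne] minp.
have agree r : r < p -> cross D r = cross D' r.
  by move=> hr; have := minp r; case: eqP => // _; rewrite andbT; lia.
have [dp|dp] := boolP (cross D p).
  have d'p := straight_out_cross_forced m_gt0 g pN agree dp
    (fun a ha => esym (same a ha)).
  by rewrite dp d'p in ne.
have d'p : cross D' p by move: ne; rewrite (negbTE dp); case: (cross D' p).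
have [/existsP[q /andP[pq dq]]|/existsPn none] :=
    boolP [exists r : 'I_(k * m), (p < r) && cross D r].
  by apply: (filter_lexi _ agree d'p dp dq); rewrite pq ltn_ord.
have ht r : r < k * m -> (strand k m r).+1 < k + m.
  by move: r; apply: (boxP m_gt0) => A B hB; rewrite ltn_rows // strand_box //; lia.
have tail r : p <= r < k * m -> ~~ cross D r.
  move=> hr; have [->//|rp] := eqVneq r p.
  by have := none (Ordinal (proj2 (andP hr))); rewrite /= ltn_neqAle eq_sym rp; lia.
have once a b q : a < k + m -> b < k + m -> p < q < k * m ->
    crossing (strand k m) (cross D') p a b -> ~~ crossing (strand k m) (cross D') q a b.
  by move=> ha hb hq; apply: red.
have [a ha []] := lost_crossing_visible pN ht agree d'p tail once.
by rewrite same.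
Qed.

Lemma straight_out_affine_bottom D : straight_out k m (cross D) -> affine_bottom D.
Proof.
move=> g; split=> // [|D']; first exact: straight_out_reduced.
exact: straight_out_max.
Qed.

Lemma affine_bottom_straight_out D : affine_bottom D -> straight_out k m (cross D).
Proof.
move=> [red _ maxD]; have [D' [g same]] := straight_out_exists D.
have eD : D = D'; last by rewrite eD.
have e : cross_positions D = cross_positions D'.
  have le1 := straight_out_max g red (fun x => esym (same x)).
  have le2 := maxD D' (straight_out_reduced g) same.
  by apply: le_anti; rewrite le1 le2.
apply/matrixP => i j; rewrite -!(crossE m_gt0 _ (i, j)).
have := congr1 (fun s : seq nat => position (i, j) \in s) e.
by rewrite !cross_positionsE !mem_filter mem_iota add0n ltn_position // !andbT.
Qed.

End Bottom.

Local Open Scope classical_set_scope.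

Theorem theorem20 (k n : nat) (hk : (1 <= k)%N) (hkn : (k < n)%N) :
  exists f : 'M[bool]_(k, n - k) -> filling k (n - k),
    set_bij [set C : 'M[bool]_(k, n - k) | cauchon C]
            [set D : filling k (n - k) | affine_bottom D] f.
Proof.
have m_gt0 : (0 < n - k)%N by rewrite subn_gt0.
exists (@mirror k (n - k)); split.
- move=> C /= cC; apply: straight_out_affine_bottom => //.
  by apply/straight_outP => //; rewrite mirrorK.
- by move=> C C' _ _; apply: (inv_inj (@mirrorK _ _)).
- move=> D /= bD; exists (mirror D); last exact: mirrorK.
  by apply/straight_outP => //; apply: affine_bottom_straight_out.
Qed.
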